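(* Let $n\in\mathbb{N}$, let $X$ and $Y$ be proper metric spaces, and let $f\colon X\to Y$ be coarse, coarsely surjective, and coarsely $n$-to-$1$. Then $$\mathrm{asdim}(Y)\le \mathrm{asdim}(X)+n-1.$$
   Context: $\mathbb{N}=\{1,2,\ldots\}$. A metric space is proper if the closure of each bounded set is compact. A map $f\colon X\to Y$ of metric spaces (not necessarily continuous) is proper if preimages of bounded sets are bounded. It is coarse if it is proper and for each $R>0$ there exists $S>0$ such that $d(x,y)\le R$ implies $d(f(x),f(y))\le S$. It is coarsely surjective if there exists $R$ such that $\inf_{a\in f(X)}d(y,a)\le R$ for all $y\in Y$. It is coarsely $n$-to-$1$ if for each $R>0$ there exists $S>0$ such that for each $A\subset Y$ of diameter at most $R$, the preimage $f^{-1}(A)$ can be covered by at most $n$ subsets of $X$ of diameter at most $S$. The asymptotic dimension $\mathrm{asdim}(X)\in\{0,1,2,\ldots\}\cup\{\infty\}$ is the smallest integer $m\geq 0$ such that for every $r>0$ there is a cover of $X$ by sets of uniformly bounded diameter such that every subset of $X$ of diameter at most $r$ meets at most $m+1$ of them ($\infty$ if no such $m$ exists). *)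

(* Defs.v *)
From HB Require Import structures.
From mathcomp Require Import all_boot all_order all_algebra.
From mathcomp Require Import all_classical all_reals all_analysis.

Set Implicit Arguments.
Unset Strict Implicit.
Unset Printing Implicit Defensive.

Import Order.TTheory GRing.Theory Num.Theory.

Local Open Scope classical_set_scope.
Local Open Scope ring_scope.
Local Open Scope card_scope.
Local Open Scope ereal_scope.

Section metric.
Context {R : realType}.

(* The empty set gets diameter -oo here rather than 0; every bound that a
   diameter is compared with below is positive or +oo, so this is harmless. *)
Definition diam {X : metricType R} (A : set X) : \bar R :=
  ereal_sup [set (mdist x y)%:E | x in A & y in A].

Definition mbounded {X : metricType R} (A : set X) : Prop := diam A < +oo.

Definition proper_space (X : metricType R) : Prop :=
  forall A : set X, mbounded A -> compact (closure A).

Definition proper_map {X Y : metricType R} (f : X -> Y) : Prop :=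
  forall B : set Y, mbounded B -> mbounded (f @^-1` B).

Definition coarse {X Y : metricType R} (f : X -> Y) : Prop :=
  proper_map f /\
  forall r : R, (0 < r)%R -> exists2 s : R, (0 < s)%R &
    forall x y : X, (mdist x y <= r)%R -> (mdist (f x) (f y) <= s)%R.

(* The infimum is taken in \bar R, so that it is +oo when X is empty. *)
Definition coarsely_surjective {X Y : metricType R} (f : X -> Y) : Prop :=
  exists r : R, forall y : Y,
    ereal_inf [set (mdist y a)%:E | a in range f] <= r%:E.

Definition coarsely_n_to_1 (n : nat) {X Y : metricType R} (f : X -> Y) : Prop :=
  forall r : R, (0 < r)%R -> exists2 s : R, (0 < s)%R &
    forall A : set Y, diam A <= r%:E ->
      exists C : set (set X), [/\ C #<= `I_n,
        (forall U, C U -> diam U <= s%:E) & f @^-1` A `<=` cover C id].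

Definition asdim_le (X : metricType R) (m : nat) : Prop :=
  forall r : R, (0 < r)%R -> exists C : set (set X), [/\ cover C id = setT,
    (exists2 s : R, (0 < s)%R & forall U, C U -> diam U <= s%:E) &
    forall B : set X, diam B <= r%:E ->
      [set U | C U /\ U `&` B !=set0] #<= `I_m.+1].

Definition asdim (X : metricType R) : \bar int :=
  match pselect (exists m, `[< asdim_le X m >]) with
  | left ex_m => (ex_minn ex_m)%:Z%:E
  | right _ => +oo
  end.

End metric.

(* Main.v *)
Require Import Defs.
From mathcomp Require Import all_boot all_order all_algebra.
From mathcomp Require Import all_classical all_reals all_analysis.
From mathcomp Require Import wochoice.
From mathcomp Require Import zify lra.

Set Implicit Arguments.
Unset Strict Implicit.
Unset Printing Implicit Defensive.

Import Order.TTheory GRing.Theory Num.Theory.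

Local Open Scope classical_set_scope.
Local Open Scope card_scope.
Local Open Scope ring_scope.

(** Say that a set is colorable by [k] colours at scale
[(r, s)] if it splits into [k] colour classes, each of which is a union of
[s]-bounded cells that are pairwise more than [r] apart.  Then asdim is at most
[m] iff for every [r] there is an [s] such that the whole space is colorable by
[m + 1] colours at scale [(r, s)] ([asdim_le_colorable], [colorable_asdim_le]).
So the claim is: if [X] needs [k] colours, then [Y] needs at most [k + n - 1].

The proof is a finite-scale version of the classical argument for a closed
[n]-to-1 map of compacta, by induction on [k] and [n].  There one cuts the domain
along a separator [B] of smaller dimension.  A point of the target whose
preimages avoid [B] and lie on both sides of it has fewer than [n] preimages on
one of the sides, so the set of these points is handled by the induction on [n];
the image of [B] is handled by the induction on the dimension.  The points that
see one side only are the interiors of the pieces, and cost one dimension.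

On the large scale [dim B < dim X] cannot hold literally, because a separator at
one scale is a thick set when it is looked at from a smaller scale.  Instead a
sequence of scales [g 0 < g 1 < ...] is fixed in advance, so sparse that [X], the
map and the fibers are under control from each scale to the next
([exists_scales]), and a partition of [X] into bounded cells is built from the
top scale down so that its frontier needs only [k - 1] colours at all scales of
any prescribed finite window at once ([thin_frontier]).

In the inductive step ([raising_boundSS]) the target splits into three parts.
Points that see a single cell of the partition are grouped by this cell, which
costs one colour.  Points near which the preimages cross the frontier are
coloured by induction on [k], at a high window of scales.  All other points see
at least two cells, and no piece of their fiber meets two cells; forgetting the
preimages in the least cell, for a fixed well-order of the cells, leaves a
correspondence with at most [n - 1] preimages, and the induction on [n] colours
these points at a low window of scales.  Since the cells of the second part are
much farther apart than the size of the cells of the third, the second and third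
part share their [k + n - 2] colours ([colorableU_saturation]). *)

(** * Colourings and covers at a given scale *)

Section scales.
Context {R : realType}.

(** The cells of a colour class are the fibres of [l] in it.  Labels are used in
place of families of sets because merging cells then means relabelling. *)
Definition colorable {X : metricType R} (k : nat) (r s : R) (E : set X) : Prop :=
  exists (T : Type) (c : X -> nat) (l : X -> T),
    (forall x, E x -> (c x < k)%N) /\
    forall x y, E x -> E y -> c x = c y ->
      (mdist x y <= r -> l x = l y) /\ (l x = l y -> mdist x y <= s).

Definition coverable {X : metricType R} (n : nat) (s : R) (A : set X) : Prop :=
  exists c : X -> nat, (forall x, A x -> (c x < n)%N) /\
    forall x y, A x -> A y -> c x = c y -> mdist x y <= s.

Section generic.
Variable X : metricType R.
Implicit Types (x y z : X) (A B E : set X).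

Lemma mdist_leD y x z (a b : R) :
  mdist x y <= a -> mdist y z <= b -> mdist x z <= a + b.
Proof.
by move=> xy yz; rewrite (le_trans (metric_triangle x y z))// lerD.
Qed.

Lemma colorable_le k (r s r' s' : R) E E' : E' `<=` E -> r' <= r -> s <= s' ->
  colorable k r s E -> colorable k r' s' E'.
Proof.
move=> sub rr ss [T [c [l [ck cl]]]]; exists T, c, l; split=> [x /sub|].
  exact: ck.
move=> x y /sub Ex /sub Ey cxy; have [h1 h2] := cl x y Ex Ey cxy.
by split=> [d|/h2 d]; [apply: h1; apply: le_trans rr|apply: le_trans ss].
Qed.

Lemma coverable_le n (s s' : R) A A' : A' `<=` A -> s <= s' ->
  coverable n s A -> coverable n s' A'.
Proof.
move=> sub ss [c [cn cd]]; exists c; split=> [x /sub|]; first exact: cn.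
by move=> x y /sub Ax /sub Ay cxy; apply: le_trans ss; exact: cd.
Qed.

Lemma colorableU_disjoint_colors k1 k2 (r s : R) A B :
  colorable k1 r s A -> colorable k2 r s B -> colorable (k1 + k2) r s (A `|` B).
Proof.
move=> [T1 [c1 [l1 [ck1 cl1]]]] [T2 [c2 [l2 [ck2 cl2]]]].
exists (T1 + T2)%type, (fun x => if `[< A x >] then c1 x else (k1 + c2 x)%N),
  (fun x => if `[< A x >] then inl (l1 x) else inr (l2 x)).
split=> [x ABx|x y ABx ABy].
  case: asboolP => [/ck1 lt|nA]; first by rewrite ltn_addr.
  by rewrite ltn_add2l; apply: ck2; case: ABx.
case: asboolP => Ax; case: asboolP => Ay.
- move=> cxy; have [h1 h2] := cl1 x y Ax Ay cxy.
  by split=> [/h1 ->//|[] /h2].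
- by have := ck1 x Ax => lt e; move: lt; rewrite e ltnNge leq_addr.
- by have := ck1 y Ay => lt e; move: lt; rewrite -e ltnNge leq_addr.
- have Bx : B x by case: ABx.
  have By : B y by case: ABy.
  move=> /addnI cxy; have [h1 h2] := cl2 x y Bx By cxy.
  by split=> [/h1 ->//|[] /h2].
Qed.

(** Cells of the finer colouring that come close to a coarse cell of the same
colour are absorbed by it.  Such a coarse cell is unique because two of them
would be at distance at most [2 r + s], which is less than the separation of the
coarse cells.  So absorption does not create chains. *)
Lemma colorableU_saturation k (r s r' s' : R) A B :
  0 <= r -> 0 <= s -> 0 <= s' -> 2 * r + s <= r' ->
  colorable k r s A -> colorable k r' s' B ->
  colorable k r (s' + 2 * (r + s)) (A `|` B).
Proof.
move=> r0 s0 s0' rr [T1 [c1 [l1 [ck1 cl1]]]] [T2 [c2 [l2 [ck2 cl2]]]].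
(* near x z: some point of the fine cell of x is within r of z *)
pose near x z := exists y, [/\ A y, ~ B y, c1 y = c1 x, l1 y = l1 x & mdist y z <= r].
pose M x : set T2 := if `[< B x >] then [set l2 x]
  else [set t | exists z, [/\ B z, c2 z = c1 x, l2 z = t & near x z]].
pose c x := if `[< B x >] then c2 x else c1 x.
(* M x is a singleton or empty: the coarse cell that absorbs x, if any.  If there
   is none, x keeps its fine label. *)
pose l x := (M x, if `[< M x !=set0 >] then None else Some (l1 x)).
have near_uniq x y z : A x -> ~ B x -> near x z -> A y -> ~ B y ->
    c1 y = c1 x -> l1 y = l1 x -> mdist y z <= r + s + r.
  move=> Ax nBx [y1 [Ay1 nBy1 cy1 ly1 d1]] Ay nBy cy ly.
  have [|_ /(_ _)] := cl1 y y1 Ay Ay1; first by rewrite cy cy1.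
  rewrite ly ly1 => /(_ erefl) d2.
  by have := mdist_leD d2 d1; lra.
have lM x y : M x = M y -> M x !=set0 -> l x = l y.
  by move=> e h; rewrite /l -e; case: asboolP.
have BM x : B x -> M x = [set l2 x] by move=> Bx; rewrite /M; case: asboolP.
have M0 x z : ~ B x -> A x -> B z -> c2 z = c1 x -> mdist x z <= r -> M x = M z.
  move=> nB Ax Bz cz d; rewrite (BM z Bz) /M; case: asboolP => // _.
  apply/seteqP; split=> t /=.
    move=> [z' [Bz' cz' <- [y [Ay nBy cy ly dy]]]].
    have [|h _] := cl2 z' z Bz' Bz; first by rewrite cz cz'.
    apply: h; have [|_ h] := cl1 x y Ax Ay; first by rewrite cy.
    have := mdist_leD (mdist_leD (h (esym ly)) dy) (lexx (mdist z' z)).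
    move: (mdist_leD (h (esym ly)) dy); rewrite (metric_sym x) => d3.
    by have := mdist_leD d3 d; lra.
  move=> ->; exists z; split=> //; exists x; split=> //.
have Mfar x t : A x -> ~ B x -> M x t ->
    exists z, [/\ B z, c2 z = c1 x, l2 z = t & mdist x z <= r + s].
  move=> Ax nBx; rewrite /M; case: asboolP => // _ [z [Bz cz lz]].
  move=> [y [Ay nBy cy ly dy]]; exists z; split=> //.
  have [|_ h] := cl1 x y Ax Ay; first by rewrite cy.
  by have := mdist_leD (h (esym ly)) dy; lra.
have Mdist x t : (A `|` B) x -> M x t ->
    exists z, [/\ B z, c2 z = c x, l2 z = t & mdist x z <= r + s].
  move=> ABx; have [Bx|nBx] := pselect (B x).
    rewrite BM// => ->; exists x; split=> //; last by rewrite mdistxx addr_ge0.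
    by rewrite /c; case: asboolP.
  rewrite /c; case: asboolP => // _; apply: Mfar => //; by case: ABx.
exists (set T2 * option T1)%type, c, l; split.
  move=> x ABx; rewrite /c; case: asboolP => [/ck2//|nB]; apply: ck1.
  by case: ABx.
move=> x y ABx ABy cxy; split=> [dxy|lxy].
  have [Bx|nBx] := pselect (B x); have [By|nBy] := pselect (B y).
  - apply: lM; last by rewrite BM//; exists (l2 x).
    rewrite !BM//; congr [set _]; move: cxy; rewrite /c !asboolT// => cxy.
    by apply: (cl2 x y Bx By cxy).1; apply: le_trans dxy _; lra.
  - apply: lM; last by rewrite BM//; exists (l2 x).
    apply/esym/M0 => //; first by case: ABy.
      by move: cxy; rewrite /c asboolT// asboolF.
    by rewrite metric_sym.
  - apply: lM; last (rewrite (M0 _ y)//; first by rewrite BM//; exists (l2 y)).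
    + apply: M0 => //; first by case: ABx.
      by move: cxy; rewrite /c asboolF// asboolT.
    + by case: ABx.
    + by move: cxy; rewrite /c asboolF// asboolT.
  - have Ax : A x by case: ABx.
    have Ay : A y by case: ABy.
    move: cxy; rewrite /c !asboolF// => cxy.
    have e := (cl1 x y Ax Ay cxy).1 dxy.
    have eM : M x = M y by rewrite /M !asboolF// /near e cxy.
    by rewrite /l eM e.
have eM : M x = M y by case: lxy.
have [[t Mt]|nM] := pselect (M x !=set0).
  have [z [Bz cz lz dz]] := Mdist x t ABx Mt.
  rewrite eM in Mt; have [z' [Bz' cz' lz' dz']] := Mdist y t ABy Mt.
  have [|_ h] := cl2 z z' Bz Bz'; first by rewrite cz cz'.
  have d2 := h (etrans lz (esym lz')).
  rewrite metric_sym in dz'.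
  by have := mdist_leD (mdist_leD dz d2) dz'; lra.
have nBx : ~ B x by move=> Bx; apply: nM; rewrite BM//; exists (l2 x).
have nBy : ~ B y by move=> By; apply: nM; rewrite eM BM//; exists (l2 y).
have Ax : A x by case: ABx.
have Ay : A y by case: ABy.
have := lxy; rewrite /l -eM; case: asboolP => // _ [lxy1].
move: cxy; rewrite /c !asboolF// => cxy.
have d1 := (cl1 x y Ax Ay cxy).2 lxy1.
by lra.
Qed.

Definition frontier (t : R) (l : X -> X) E : set X :=
  [set x | E x /\ exists x', [/\ E x', mdist x x' <= t & l x <> l x']].

(** The last colour is collapsed: every point within [t] of one of its cells is
sent to a common base point of that cell, and all other points stay put.  The
resulting map is constant around each point of the last colour, so only the
other colours meet its frontier. *)
Lemma collapse_last_color k (r s t : R) E : 0 <= t -> 0 <= s -> 2 * t <= r ->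
  colorable k.+1 r s E ->
  exists w : X -> X, [/\ forall x, E x -> E (w x),
    forall x, E x -> mdist x (w x) <= t + s &
    colorable k r s (frontier t w E)].
Proof.
move=> t0 s0 tr [T [c [l [ck cl]]]].
pose U (q : T) := [set u | [/\ E u, c u = k & l u = q]].
pose N x := [set u | U (l u) u /\ mdist x u <= t].
pose base q := if pselect (U q !=set0) is left h then Some (projT1 (cid h)) else None.
pose w x := if pselect (N x !=set0) is left h
  then odflt x (base (l (projT1 (cid h)))) else x.
have Ul x u v : N x u -> N x v -> l u = l v.
  move=> [[Eu cu _] du] [[Ev cv _] dv].
  have [|h _] := cl u v Eu Ev; first by rewrite cu.
  apply: h; rewrite metric_sym in du.
  by have := mdist_leD du dv; lra.
have wP x u : N x u -> base (l u) = Some (w x) /\ U (l u) (w x).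
  move=> Nu; rewrite /w; case: pselect => [h|]; last by case; exists u.
  have -> : l (projT1 (cid h)) = l u by apply: Ul Nu; exact: (projT2 (cid h)).
  rewrite /base; case: pselect => [h'|]; last by case; exists u; case: Nu.
  by split=> //=; exact: (projT2 (cid h')).
have w0 x : ~ (N x !=set0) -> w x = x by rewrite /w; case: pselect.
exists w; split.
- move=> x Ex; have [[u Nu]|/w0 ->//] := pselect (N x !=set0).
  by case: (wP x u Nu) => _ [].
- move=> x Ex; have [[u Nu]|/w0 ->] := pselect (N x !=set0); last first.
    by rewrite mdistxx addr_ge0.
  have [_ [Ew cw lw]] := wP x u Nu; case: Nu => -[Eu cu _] du.
  apply: (mdist_leD du); apply: (cl u (w x) Eu Ew _).2 => //.
  by rewrite cu.
- exists T, c, l; split=> [x [Ex [x' [Ex' d ne]]]|x y [Ex _] [Ey _]]; last exact: cl.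
  have := ck x Ex; rewrite ltnS leq_eqVlt => /orP[/eqP cx|//].
  have Nx : N x x by split=> //; rewrite mdistxx.
  have Nx' : N x' x by split=> //; rewrite metric_sym.
  have [bx _] := wP x x Nx; have [bx' _] := wP x' x Nx'.
  by exfalso; apply: ne; apply: Some_inj; rewrite -bx -bx'.
Qed.

(** If [l] separates [w x] from [w x'], where [x'] is within [t] of [x], then it
separates [x] from one of them, and both are within [t + 2 * d] of [x]. *)
Lemma frontier_comp (t d : R) (l w : X -> X) E : 0 <= t -> 0 <= d ->
  (forall x, E x -> E (w x)) -> (forall x, E x -> mdist x (w x) <= d) ->
  frontier t (l \o w) E `<=` frontier (t + 2 * d) l E.
Proof.
move=> t0 d0 Ew dw x [Ex [x' [Ex' dx ne]]]; split=> //.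
have [e|ne'] := pselect (l x = l (w x)).
  exists (w x'); split; [exact: Ew| |by move=> e'; apply: ne; rewrite /= -e].
  by have := mdist_leD dx (dw x' Ex'); lra.
by exists (w x); split; [exact: Ew|have := dw x Ex; lra|].
Qed.

(** The factor [10] in the separation leaves room for collars of width [3 * g i]
around the cells. *)
Definition colorable_scales (g : nat -> R) (k b N : nat) E :=
  forall i, (b <= i < b + N)%N -> colorable k (10 * g i) (g i.+1) E.

(** Cells of the last colour are absorbed from the largest scale of the window down
to the smallest.  Each absorption spoils the earlier ones only by moving the
frontier by a distance that is small compared to their scale; this is why a
single partition serves all scales of the window. *)
Lemma thin_frontier (g : nat -> R) k N b E :
  (forall i, 0 < g i) -> (forall i, 100 * g i <= g i.+1) ->
  colorable_scales g k.+1 b N E ->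
  exists l : X -> X,
    (forall x y, E x -> E y -> l x = l y -> mdist x y <= g (b + 2 * N)%N) /\
    colorable_scales g k b N (frontier (3 * g b) l E).
Proof.
move=> g0 gS; elim: N b => [|N IH] b hE.
  exists id; split=> [x y _ _ -> |i]; last by rewrite addn0 ltnNge andbN.
  by rewrite mdistxx ltW.
have [i bi|l [lE lf]] := IH b.+1; first by apply: hE; lia.
have gb := g0 b; have gSb := gS b.
have [||||w [wE dw wf]] := @collapse_last_color k (10 * g b) (g b.+1) (3 * g b) E.
- lra.
- by apply/ltW.
- lra.
- by apply: hE; lia.
exists (l \o w); split=> [x y Ex Ey e|i bi].
  have d := lE _ _ (wE x Ex) (wE y Ey) e.
  have dx := dw x Ex; have dy := dw y Ey; rewrite metric_sym in dy.
  have := mdist_leD (mdist_leD dx d) dy.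
  have -> : (b + 2 * N.+1 = (b.+1 + 2 * N).+1)%N by lia.
  have h : g b.+1 <= g (b.+1 + 2 * N)%N.
    elim: (2 * N)%N => [|M hM]; first by rewrite addn0.
    rewrite addnS; have := gS (b.+1 + M)%N; have := g0 (b.+1 + M)%N; lra.
  by have := gS (b.+1 + 2 * N)%N; lra.
have [<-|ne] := eqVneq b i.
  apply: colorable_le (wf) => // x [Ex [x' [Ex' d ne]]].
  by split=> //; exists x'; split=> //= e; apply: ne; rewrite /= e.
apply: colorable_le (lf i _) => //; last by lia.
apply: subset_trans (frontier_comp _ _ wE dw) _; [lra|lra|].
move=> x [Ex [x' [Ex' d ne']]]; split=> //; exists x'; split=> //.
apply: le_trans d _; lra.
Qed.

End generic.

(** * Colouring the target by induction *)

Section main_induction.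
Variables (X Y : metricType R) (f : X -> Y) (g : nat -> R).
Hypothesis g_gt0 : forall i, 0 < g i.
Hypothesis g_grow : forall i, 100 * g i <= g i.+1.
Hypothesis f_ctrl : forall i x x', mdist x x' <= g i -> mdist (f x) (f x') <= g i.+1.

Lemma scale_le i j : (i <= j)%N -> g i <= g j.
Proof.
move=> /subnK <-; elim: (j - i)%N => [|M h]; first by rewrite add0n.
by rewrite addSn; have := g_grow (M + i); have := g_gt0 (M + i); lra.
Qed.

Lemma scale_lt i j : (i < j)%N -> 100 * g i <= g j.
Proof. by move=> /scale_le; apply: le_trans. Qed.

(** Preimages are taken with respect to a relation [G] in place of a map, since the
induction discards a preimage of one point while keeping it for a neighbouring
point. *)
Definition fiber (G : X -> Y -> Prop) (D : set Y) (t : R) (y : Y) : set X :=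
  [set x | exists y', [/\ D y', mdist y y' <= t & G x y']].

(** Each inductive call enlarges fibers by a smaller scale, hence moves them into
the next one, without changing the size of the pieces that cover them.  The shift
[e] between the two scales absorbs this. *)
Definition few_fibers (G : X -> Y -> Prop) (D : set Y) n e a N :=
  forall i y, (a <= i < a + N)%N -> D y ->
    coverable n (g (i + e)) (fiber G D (g i) y).

Definition dom (G : X -> Y -> Prop) (D : set Y) : set X :=
  [set x | exists2 y, D y & G x y].

(** The length [N] of the window of scales depends on [k], [n] and [e] only.  This
is what allows the inductive step to reserve consecutive windows for its two
recursive calls before the relations that they are applied to are known. *)
Definition raising_bound k n := forall e, exists N,
  forall a (D : set Y) (G : X -> Y -> Prop),
  (forall y, D y -> exists x, G x y) ->
  (forall x y, G x y -> mdist (f x) y <= g a) ->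
  few_fibers G D n e a N ->
  colorable_scales g k a N (dom G D) ->
  colorable (k + n).-1 (g a) (g (a + N)%N) D.

(** The hypothesis quantifies over all colourings because the piece that [A'] avoids
depends on how [A] is covered. *)
Lemma coverable_drop n s (A A' : set X) : A' `<=` A ->
  (forall c : X -> nat, (forall x y, A x -> A y -> c x = c y -> mdist x y <= s) ->
     exists2 x0, A x0 & forall x, A' x -> c x <> c x0) ->
  coverable n.+1 s A -> coverable n s A'.
Proof.
move=> sub h [c [cn cd]]; have [x1 Ax1 hx1] := h c cd.
exists (fun x => unbump (c x1) (c x)); split=> [x A'x|x y A'x A'y e].
  have := cn x (sub x A'x); have := hx1 x A'x; have := cn x1 Ax1.
  by rewrite /unbump; lia.
apply: cd; [exact: sub|exact: sub|].
by move: e (hx1 x A'x) (hx1 y A'y); rewrite /unbump; lia.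
Qed.

(** The strict part of a well-order.  It singles out one cell among any nonempty
set of cells, coherently for all sets of cells at once. *)
Lemma exists_order_with_minima (T : eqType) : exists2 lt : T -> T -> Prop,
  forall p q, p <> q -> lt p q \/ lt q p &
  forall S : set T, S !=set0 -> exists2 p, S p & forall q, S q -> ~ lt q p.
Proof.
have [r wr] := well_ordering_principle T.
have wo : wo_chain r predT by apply: withinW.
exists (fun p q => ~~ r q p).
  move=> p q ne; apply/orP; rewrite -negb_and; apply/negP => /andP[rqp rpq].
  by apply: ne; apply: (wo_chain_antisymmetric wo) => //; rewrite rpq.
move=> S [p Sp]; have [|z [[zin zle] _]] := wr (fun p => `[< S p >]).
  by exists p; rewrite unfold_in; apply/asboolP.
exists z; first by move: zin; rewrite unfold_in => /asboolP.
by move=> q Sq; rewrite zle// unfold_in; apply/asboolP.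
Qed.

Lemma raising_bound0n n : raising_bound 0 n.
Proof.
move=> e; exists 1 => a D G H1 _ _ H4.
have D0 y : ~ D y.
  move=> Dy; have [x Gx] := H1 y Dy.
  have [|T [c [l [/(_ x) h _]]]] := H4 a; first by lia.
  by have := h (ex_intro2 _ _ y Dy Gx).
exists unit, (fun=> 0%N), (fun=> tt); split=> [y /D0//|y ? /D0//].
Qed.

Lemma raising_boundn0 k : raising_bound k 0.
Proof.
move=> e; exists 1 => a D G H1 _ H3 _.
have D0 y : ~ D y.
  move=> Dy; have [x Gx] := H1 y Dy.
  have [|c [/(_ x) h _]] := H3 a y _ Dy; first by lia.
  have : fiber G D (g a) y x by exists y; split=> //; rewrite mdistxx ltW.
  by move=> /h.
exists unit, (fun=> 0%N), (fun=> tt); split=> [y /D0//|y ? /D0//].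
Qed.

(** The sets [D1], [W] and [V] are the three parts of the target: one cell seen,
fiber crossing the frontier, and the rest.  The windows are [a.+1, ...) of length
[N1] for [V], followed by [b, ...) of length [N2] for [W].  The relation [GV]
keeps the preimages whose cell is not the least one seen from [y].  For [y] in
[V] and all points of [V] near [y], the cells seen are among those of one
fiber of [y]; the least cell [p] of all of them is forgotten at each of these
points, either because it is not seen or because it is the least one there.  So
the piece of the fiber that lies in [p] can be dropped. *)
Lemma raising_boundSS k n :
  raising_bound k.+1 n -> raising_bound k n.+1 -> raising_bound k.+1 n.+1.
Proof.
move=> IHn IHk e; have [N1 h1] := IHn e.+1; have [N2 h2] := IHk e.+1.
exists (N1 + e + 2 * N2 + 10)%N => a D G H1 H2 H3 H4.
pose j := (a + N1 + e + 3)%N; pose b := j.+1.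
have [i bi|l [lE lf]] := @thin_frontier _ g k N2 b (dom G D) g_gt0 g_grow.
  by apply: H4; lia.
have [lt lt_tot lt_min] := exists_order_with_minima X.
pose near := fiber G D (g a).
have nearG y x : D y -> G x y -> near y x.
  by move=> Dy Gxy; exists y; split=> //; rewrite mdistxx ltW.
pose B := frontier (3 * g b) l (dom G D).
pose D1 := [set y | D y /\ forall x x', near y x -> near y x' -> l x = l x'].
(* The scale g j exceeds all scales, and all sizes of pieces of fibers, of the
   call for V; hence the fibers of points outside W do not cross the frontier in
   that call. *)
pose W := [set y | D y /\ exists x x', [/\ fiber G D (g j) y x, fiber G D (g j) y x',
  mdist x x' <= g j & l x <> l x']].
pose V := [set y | [/\ D y, ~ D1 y & ~ W y]].
pose GV x y := near y x /\ exists2 x0, near y x0 & lt (l x0) (l x).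
pose GW x y := B x /\ fiber G D (g j) y x.
have gaj : 100 * g a <= g j by apply: scale_lt; lia.
have gjb : 100 * g j <= g b by apply: scale_lt.
have ga0 := g_gt0 a.
have colV : colorable (k.+1 + n).-1 (g a.+1) (g (a.+1 + N1)%N) V.
  apply: (h1 a.+1 V GV).
  - move=> y [Dy nD1 nW].
    have [x [x' [nx [nx' ne]]]] : exists x x', near y x /\ near y x' /\ l x <> l x'.
      apply: contrapT => h; apply: nD1; split=> // x x' nx nx'.
      by apply: contrapT => ne; apply: h; exists x, x'.
    have [h|h] := lt_tot _ _ ne; first by exists x'; split=> //; exists x.
    by exists x; split=> //; exists x'.
  - move=> x y [[y' [Dy' d Gxy']] _]; rewrite metric_sym in d.
    by have := mdist_leD (H2 x y' Gxy') d; have := scale_lt (ltnSn a); lra.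
  - move=> i y ai [Dy nD1 nW].
    have sub t : t <= g i -> fiber (fun x y => near y x) V t y `<=` fiber G D (g i.+1) y.
      move=> ti x [y' [[Dy' _ _] d [y'' [Dy'' d' Gx]]]]; exists y''; split=> //.
      have gai : g a <= g i by apply: scale_le; lia.
      by have := mdist_leD d d'; have := scale_lt (ltnSn i); have := g_gt0 i; lra.
    have subj : fiber G D (g i.+1) y `<=` fiber G D (g j) y.
      move=> x [y' [Dy' d Gx]]; exists y'; split=> //; apply: le_trans d _.
      by apply: scale_le; lia.
    pose A0 := fiber (fun x y => near y x) V (g i) y.
    have [p [x0 A0x0 <-] pmin] : exists2 p, (l @` A0) p & forall q, (l @` A0) q -> ~ lt q p.
      apply: lt_min; have [x Gx] := H1 y Dy; exists (l x); exists x => //.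
      by exists y; split=> //; [rewrite mdistxx ltW|exact: nearG].
    apply: (@coverable_drop _ _ (fiber G D (g i.+1) y)).
    + move=> x [y' [Vy' d [nx _]]]; apply: sub (lexx _) _ _.
      by exists y'.
    + move=> c cd; exists x0; first exact: sub A0x0.
      move=> x [y' [Vy' d [nx [x1 nx1 ltx1]]]] cx.
      have Ax0 := sub _ (lexx _) _ A0x0.
      have A0x : A0 x by exists y'.
      have Ax := sub _ (lexx _) _ A0x.
      have lx : l x = l x0.
        apply: contrapT => ne; apply: nW; split=> //; exists x, x0.
        split=> //; [exact: subj|exact: subj|].
        by apply: le_trans (cd x x0 Ax Ax0 cx) _; apply: scale_le; lia.
      apply: (pmin (l x1)); last by rewrite -lx.
      by exists x1 => //; exists y'.
    + by rewrite addnS -addSn; apply: H3 => //; lia.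
  - move=> i ai; apply: colorable_le (H4 i _) => //; last by lia.
    by move=> x [y _ [[y' [Dy' _ Gx]] _]]; exists y'.
have colW : colorable (k + n.+1).-1 (g b) (g (b + N2)%N) W.
  apply: (h2 b W GW).
  - move=> y [Dy [x [x' [nx nx' d ne]]]]; exists x; split=> //; split.
      by case: nx => y' [Dy' _ Gx]; exists y'.
    exists x'; split=> //; first by case: nx' => y' [Dy' _ Gx]; exists y'.
    by have := g_gt0 j; lra.
  - move=> x y [_ [y' [Dy' d Gxy']]]; rewrite metric_sym in d.
    by have := mdist_leD (H2 x y' Gxy') d; lra.
  - move=> i y bi [Dy _]; rewrite addnS -addSn.
    apply: coverable_le (lexx _) (H3 i.+1 y _ Dy); last by lia.
    move=> x [y' [Wy' d [_ [y'' [Dy'' d' Gx]]]]]; exists y''; split=> //.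
    have gji : g j <= g i by apply: scale_le; lia.
    by have := mdist_leD d d'; have := scale_lt (ltnSn i); have := g_gt0 i; lra.
  - move=> i bi; apply: colorable_le (lf i _) => //.
    by move=> x [y _ [Bx _]].
have colVW : colorable (k + n).+1.-1 (g a) (g (b + N2).+1) (V `|` W).
  have gV0 := g_gt0 (a.+1 + N1)%N; have gW0 := g_gt0 (b + N2)%N.
  have gVb : 100 * g (a.+1 + N1)%N <= g b by apply: scale_lt; lia.
  have gab : 100 * g a <= g b by apply: scale_lt; lia.
  have gbN : g b <= g (b + N2)%N by apply: scale_le; lia.
  have gS := scale_lt (ltnSn (b + N2)).
  pose s := g (b + N2)%N + 2 * (g a + g (a.+1 + N1)%N).
  apply: (@colorable_le _ _ (g a) s _ _ (V `|` W)) => //; rewrite /s.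
    lra.
  apply: (@colorableU_saturation _ _ _ _ (g b)); [lra|lra|lra|lra| |].
    apply: colorable_le colV => //; apply: scale_le; lia.
  by move: colW; rewrite addnS.
have colD1 : colorable 1 (g a) (g (b + 2 * N2 + 3)%N) D1.
  exists (set X), (fun=> 0%N), (fun y => l @` near y); split=> // y y' [Dy ly] [Dy' ly'] _.
  have [x Gx] := H1 y Dy; have [x' Gx'] := H1 y' Dy'.
  have nx := nearG _ _ Dy Gx; have nx' := nearG _ _ Dy' Gx'.
  have im : l @` near y = [set l x].
    apply/seteqP; split=> [_ [z nz <-]|_ ->] /=; last by exists x.
    exact: ly.
  have im' : l @` near y' = [set l x'].
    apply/seteqP; split=> [_ [z nz <-]|_ ->] /=; last by exists x'.
    exact: ly'.
  split=> [d|]; rewrite im im'.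
    congr [set _]; apply: ly' => //; exists y; split=> //.
    by rewrite metric_sym.
  move=> e0; have exx' : l x = l x' by have : [set l x'] (l x) by rewrite -e0.
  have dx : mdist x x' <= g (b + 2 * N2)%N by apply: lE exx'; [exists y|exists y'].
  have := mdist_leD (f_ctrl dx) (H2 _ _ Gx'); have d := H2 _ _ Gx.
  rewrite metric_sym in d; move=> /(mdist_leD d).
  have : g a <= g (b + 2 * N2)%N by apply: scale_le; lia.
  have : 100 * g (b + 2 * N2)%N <= g (b + 2 * N2).+1 by apply: scale_lt.
  have : 100 * g (b + 2 * N2).+1 <= g (b + 2 * N2 + 3)%N by apply: scale_lt; lia.
  have := g_gt0 (b + 2 * N2).+1; have := g_gt0 (b + 2 * N2); lra.
have -> : (k.+1 + n.+1).-1 = (1 + (k + n).+1.-1)%N by lia.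
apply: (@colorable_le _ _ (g a) (g (b + 2 * N2 + 3)%N) _ _ (D1 `|` (V `|` W))) => //.
- move=> y Dy; have [|nD1] := pselect (D1 y); first by left.
  by right; have [|nW] := pselect (W y); [right|left].
- by apply: scale_le; lia.
apply: colorableU_disjoint_colors => //.
by apply: colorable_le colVW => //; apply: scale_le; lia.
Qed.

Lemma raising_boundP k n : raising_bound k n.
Proof.
elim: k n => [|k IHk] n; first exact: raising_bound0n.
elim: n => [|n IHn]; first exact: raising_boundn0.
exact: raising_boundSS.
Qed.

End main_induction.

(** * Translation to and from asymptotic dimension *)

Section translation.
Variable X : metricType R.

Lemma diam_leP (A : set X) (r : R) :
  (diam A <= r%:E)%E <-> forall x y, A x -> A y -> mdist x y <= r.
Proof.
split=> [h x y Ax Ay|h].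
  rewrite -lee_fin; apply: le_trans h.
  by apply: ereal_sup_ubound; exists x => //; exists y.
by apply: ge_ereal_sup => _ [x Ax [y Ay <-]]; rewrite lee_fin; exact: h.
Qed.

Lemma card_le_IIP (T : Type) (A : set T) n :
  A #<= `I_n <-> exists2 c : T -> nat, set_fun A `I_n c & set_inj A c.
Proof.
split=> [/pcard_leP/injfunPex //|h]; apply/pcard_leP/injfunPex; exact: h.
Qed.

(** Let [M j x] be the set of members of the cover that come within [j * r] of
[x].  These sets increase with [j]; the multiplicity bound makes the chain
[M 0 x, ..., M m.+1 x] stationary somewhere, say between [j] and [j.+1], and this
[j] is the colour of [x].  For two points of colour [j] within distance [r] of
each other the sets [M j] agree, so they can serve as labels. *)
Lemma asdim_le_colorable m (r : R) : asdim_le X m -> 0 < r ->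
  exists2 s : R, 0 < s & colorable m.+1 r s [set: X].
Proof.
move=> adX r0; pose t j : R := j%:R * r.
have tS j : t j.+1 = t j + r by rewrite /t -natr1 mulrDl mul1r.
have t0 j : 0 <= t j by rewrite mulr_ge0// ltW.
have tm1 : 0 < t m.+1 by rewrite tS; have := t0 m; lra.
have [|C [Ccov [s s0 Cs] Cmult]] := adX (2 * t m.+1); first by lra.
pose M j x := [set U | C U /\ exists2 u, U u & mdist x u <= t j].
have MS j x y : mdist x y <= r -> M j x `<=` M j.+1 y.
  move=> d U [CU [u Uu du]]; split=> //; exists u => //.
  by rewrite metric_sym in d; rewrite tS addrC; exact: mdist_leD d du.
have M0 x : M 0%N x !=set0.
  have : [set: X] x by [].
  rewrite -Ccov => -[U CU Ux]; exists U; split=> //; exists x => //.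
  by rewrite mdistxx.
have Mmon i j x : (i <= j)%N -> M i x `<=` M j x.
  move=> /subnK <-; elim: (j - i)%N => [//|p h]; rewrite addSn.
  by apply: subset_trans h (MS _ _ _ _); rewrite mdistxx ltW.
have stat x : exists2 j, (j < m.+1)%N & M j x = M j.+1 x.
  apply: contrapT => h.
  (* Otherwise each of M 0 x, ..., M m.+1 x has a member that is not in the
     previous ones, which makes m.+2 members in M m.+1 x. *)
  have : `I_m.+2 #<= `I_m.+1; last by rewrite card_le_II ltnn.
  have pick j : exists U, (j < m.+2)%N -> M j x U /\ forall i, (i < j)%N -> ~ M i x U.
    case: j => [|j]; first by have [U MU] := M0 x; exists U.
    have [jm|jm] := ltnP j m.+1; last by exists set0; rewrite ltnS ltnNge jm.
    have [U MU nMU] : exists2 U, M j.+1 x U & ~ M j x U.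
      apply: contrapT => nex; apply: h; exists j => //; apply/seteqP; split.
        by apply: Mmon.
      by move=> U MU; apply: contrapT => nMU; apply: nex; exists U.
    exists U => _; split=> // i ij MiU; apply: nMU; apply: Mmon MiU.
    by rewrite -ltnS.
  have [u hu] := choice pick.
  have : [set U | C U /\ U `&` [set y | mdist x y <= t m.+1] !=set0] #<= `I_m.+1.
    apply: Cmult; apply/diam_leP => y z /= dy dz; rewrite metric_sym in dy.
    by have := mdist_leD dy dz; lra.
  move=> /card_le_IIP[c cI cinj]; apply/card_le_IIP.
  have Mball j U : (j < m.+2)%N -> M j x U ->
      C U /\ U `&` [set y | mdist x y <= t m.+1] !=set0.
    by move=> jm /(Mmon j m.+1)[//|CU [y Uy dy]]; split=> //; exists y.
  have uM j : (j < m.+2)%N -> C (u j) /\ u j `&` [set y | mdist x y <= t m.+1] !=set0.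
    by move=> jm; apply: (Mball j _ jm); exact: (hu j jm).1.
  exists (c \o u); first by move=> j /= jm; apply: cI; exact: uM.
  move=> i j; rewrite !inE /= => im jm e.
  have {}e : u i = u j by apply: cinj => //; rewrite inE; exact: uM.
  have [ij|ji|//] := ltngtP i j.
    by have [Mi _] := hu i im; have [_ /(_ i ij)] := hu j jm; rewrite -e.
  by have [Mj _] := hu j jm; have [_ /(_ j ji)] := hu i im; rewrite e.
have /choice[c cP] x : exists j, (j < m.+1)%N /\ M j x = M j.+1 x.
  by have [j jm e] := stat x; exists j.
exists (s + 2 * t m.+1); first by lra.
exists (set (set X)), c, (fun x => M (c x) x); split=> [x _|x y _ _ cxy].
  by have [] := cP x.
have [_ ex] := cP x; have [_ ey] := cP y; split=> [d|e].
  apply/seteqP; split; first by rewrite ey -cxy; exact: MS.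
  by rewrite ex -cxy; apply: MS; rewrite metric_sym.
have [U MU] := M0 x.
have /(Mmon _ m.+1)[|CU [u Uu du]] : M (c x) x U by apply: Mmon MU.
  by have [/ltnW] := cP x.
have /(Mmon _ m.+1)[|_ [v Uv dv]] : M (c y) y U by rewrite -e; apply: Mmon MU.
  by have [/ltnW] := cP y.
have /diam_leP/(_ u v Uu Uv) duv := Cs U CU; rewrite metric_sym in dv.
by have := mdist_leD (mdist_leD du duv) dv; lra.
Qed.

Lemma colorable_asdim_le m :
  (forall r : R, 0 < r -> exists s : R, colorable m.+1 r s [set: X]) ->
  asdim_le X m.
Proof.
move=> h r r0; have [s [T [c [l [cm cl]]]]] := h r r0.
pose K x := [set y | c y = c x /\ l y = l x].
exists [set U | exists x, U = K x]; split.
- by apply/seteqP; split=> // x _; exists (K x) => //; exists x.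
- (* s need not be positive *)
  exists (Num.max s 1); first by rewrite lt_max ltr01 orbT.
  move=> _ [x ->]; apply/diam_leP => y z [cy ly] [cz lz].
  rewrite le_max; apply/orP; left.
  by apply: (cl y z _ _ _).2 => //; [rewrite cy cz|rewrite ly lz].
- move=> B /diam_leP dB; apply/card_le_IIP.
  pose k U := if pselect (U `&` B !=set0) is left p then c (projT1 (cid p)) else 0%N.
  have kP U : U `&` B !=set0 -> exists x, [/\ U x, B x & k U = c x].
    move=> p; rewrite /k; case: pselect => // p'; case: cid => x /= [Ux Bx].
    by exists x.
  exists k => [U [_ /kP[x [_ _ ->]]] /=|U V]; first exact: cm.
  rewrite !inE => -[[x ->] /kP[x' [[cx lx] Bx' ->]]] [[y ->] /kP[y' [[cy ly] By' ->]]] e.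
  have exy := (cl x' y' I I e).1 (dB _ _ Bx' By').
  by rewrite /K -cx -lx e exy cy ly.
Qed.

Lemma asdim_finite : (asdim X < +oo)%E ->
  exists2 m, asdim_le X m & asdim X = (m%:Z%:E)%E.
Proof.
rewrite /asdim; case: pselect => [h _|//].
by case: ex_minnP => m /asboolP adm _; exists m.
Qed.

Lemma asdim_leE m : asdim_le X m -> (asdim X <= m%:Z%:E)%E.
Proof.
move=> adm; rewrite /asdim; case: pselect => [h|]; last first.
  by case; exists m; apply/asboolP.
by case: ex_minnP => p _ /(_ m); rewrite lee_fin lez_nat; apply; apply/asboolP.
Qed.

End translation.
Section raising.
Variables (X Y : metricType R) (f : X -> Y).

Lemma coarsely_n_to_1_coverable n (a : R) : coarsely_n_to_1 n f -> 0 < a ->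
  exists b : R, forall y, coverable n b (f @^-1` [set y' | mdist y y' <= a]).
Proof.
move=> fn a0; have [|s s0 hs] := fn (2 * a); first by lra.
exists s => y; pose A := [set y' | mdist y y' <= a].
have [|C [/card_le_IIP[k kn kinj] Cs Ccov]] := hs A.
  apply/diam_leP => u v; rewrite /A /= metric_sym => yu yv.
  by have := mdist_leD yu yv; lra.
have /choice[U UP] x : exists U, A (f x) -> C U /\ U x.
  have [Ax|nA] := pselect (A (f x)); last by exists set0 => /nA.
  by have [U CU Ux] := Ccov x Ax; exists U.
exists (k \o U); split=> [x Ax|x x' Ax Ax' e].
  by apply: kn; exact: (UP x Ax).1.
have [CU Ux] := UP x Ax; have [CU' Ux'] := UP x' Ax'.
have eU : U x = U x' by apply: kinj => //; rewrite inE.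
by have /diam_leP/(_ x x' Ux) := Cs _ CU; apply; rewrite eU.
Qed.

(** Each requirement on the next scale survives enlarging it, so one function
provides a next scale that meets all of them, and iterating it gives [g]. *)
Lemma exists_scales m n (a : R) : 0 < a ->
  asdim_le X m -> coarse f -> coarsely_n_to_1 n f ->
  exists g : nat -> R, [/\ g 0%N = a, forall i, 0 < g i,
    forall i, 100 * g i <= g i.+1,
    forall i x x', mdist x x' <= g i -> mdist (f x) (f x') <= g i.+1 &
    forall i, colorable m.+1 (10 * g i) (g i.+1) [set: X] /\
      forall y, coverable n (g i.+1) (f @^-1` [set y' | mdist y y' <= g i])].
Proof.
move=> a0 adX [_ fc] fn.
have /choice[h hP] r : exists s : R, 0 < r -> [/\ 100 * r <= s,
    forall x x', mdist x x' <= r -> mdist (f x) (f x') <= s,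
    colorable m.+1 (10 * r) s [set: X] &
    forall y, coverable n s (f @^-1` [set y' | mdist y y' <= r])].
  have [r0|] := ltP 0 r; last by exists 0.
  have [|s1 s10 h1] := asdim_le_colorable adX (_ : 0 < 10 * r); first by lra.
  have [s2 s20 h2] := fc r r0; have [s3 h3] := coarsely_n_to_1_coverable fn r0.
  have s30 := normr_ge0 s3; have s3s := ler_norm s3.
  exists (100 * r + s1 + s2 + `|s3|) => _; split; first by lra.
  - by move=> x x' /h2 d; lra.
  - by apply: colorable_le h1 => //; lra.
  - by move=> y; apply: coverable_le (h3 y) => //; lra.
pose g i := iter i h a.
have g0 i : 0 < g i.
  by elim: i => // i IH; have [+ _ _ _] := hP _ IH; rewrite /g iterS -/(g i); lra.
exists g; split=> // i; have [h1 h2 h3 h4] := hP _ (g0 i) => //.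
Qed.

(** The relation starting the induction is that of being within [g 0] of the
image, which has no empty fiber because [g 0] exceeds the constant of coarse
surjectivity. *)
Lemma asdim_le_raise m n : (0 < n)%N -> asdim_le X m ->
  coarse f -> coarsely_surjective f -> coarsely_n_to_1 n f ->
  asdim_le Y (m + n).-1.
Proof.
move=> n0 adX fc [p fs] fn; apply: colorable_asdim_le => r r0.
pose a := r + `|p| + 1.
have pa : p < a by have := ler_norm p; rewrite /a; lra.
have a0 : 0 < a by have := normr_ge0 p; rewrite /a; lra.
have [g [ga g0 gS fg gP]] := exists_scales a0 adX fc fn.
have [N hN] := raising_boundP g0 gS fg m.+1 n 2.
exists (g N).
have := hN 0%N [set: Y] (fun x y => mdist (f x) y <= g 0%N).
have -> : (m.+1 + n).-1 = (m + n).-1.+1 by lia.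
rewrite add0n => /(_ _ _ _ _)/(colorable_le (@subset_refl _ setT) _ (lexx _)).
apply => //.
- by rewrite ga /a; have := normr_ge0 p; lra.
- move=> y _; have : (ereal_inf [set (mdist y a)%:E | a in range f] < a%:E)%E.
    by apply: le_lt_trans (fs y) _; rewrite lte_fin.
  move=> /ereal_inf_lt[_ [_ [x _ <-] <-]]; rewrite lte_fin => d; exists x.
  by rewrite ga metric_sym ltW.
- move=> i y _ _; rewrite addn2; apply: coverable_le (lexx _) ((gP i.+1).2 y).
  move=> x [y' [_ d d']] /=; rewrite metric_sym in d'.
  have := mdist_leD d d'; have := gS i; have := g0 i.
  by have := scale_le g0 gS (leq0n i); lra.
- by move=> i _; apply: colorable_le (gP i).1.
Qed.

End raising.
End scales.

Theorem theorem1p2 (R : realType) (n : nat) (X Y : metricType R) (f : X -> Y) :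
  (0 < n)%N ->
  proper_space X -> proper_space Y ->
  coarse f -> coarsely_surjective f -> coarsely_n_to_1 n f ->
  (asdim Y <= asdim X + n%:Z%:E - 1%:E)%E.
Proof.
move=> n0 _ _ fc fs fn.
have [->|] := eqVneq (asdim X) +oo%E; first by rewrite leey.
rewrite -ltey => /asdim_finite[m adX ->].
apply: le_trans (asdim_leE (asdim_le_raise n0 adX fc fs fn)) _.
have -> : (m%:Z%:E + n%:Z%:E - 1%:E)%E = (m%:Z + n%:Z - 1)%:E by [].
by rewrite lee_fin; lia.
Qed.
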